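(* Let $n$ and $p$ be two positive integers with $p\geq 3$. For every connected $n$-vertex graph $G$, $\mathcal{E}^-_p(G)\geq\mathcal{E}^-_p(K_n)$.
   Context: All graphs are finite and simple. $K_n$ is the complete graph on $n$ vertices. For an $n$-vertex graph $G$, let $\lambda_1(G)\geq\cdots\geq\lambda_n(G)$ be the eigenvalues (with multiplicity) of its adjacency matrix. For an integer $p\geq 2$, the negative $p$-energy of $G$ is $\mathcal{E}^-_p(G)=\sum_{i:\lambda_i(G)<0}|\lambda_i(G)|^p$. *)

(* Defs.v *)
From mathcomp Require Import all_boot all_order all_algebra.
From mathcomp Require Import reals polyrcf complex.

Set Implicit Arguments.
Unset Strict Implicit.
Unset Printing Implicit Defensive.

Import Order.TTheory GRing.Theory Num.Theory.
Local Open Scope ring_scope.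

Record sgraph := SGraph {
  svertex :> finType;
  sedge : rel svertex;
  sedge_sym : symmetric sedge;
  sedge_irrefl : irreflexive sedge
}.

Definition sg_connected (G : sgraph) : Prop :=
  forall x y : G, connect (@sedge G) x y.

Definition complete_rel (n : nat) : rel 'I_n := fun x y => x != y.

Lemma complete_rel_sym n : symmetric (@complete_rel n).
Proof. by move=> x y; rewrite /complete_rel eq_sym. Qed.

Lemma complete_rel_irrefl n : irreflexive (@complete_rel n).
Proof. by move=> x; rewrite /complete_rel eqxx. Qed.

Definition complete_graph (n : nat) : sgraph :=
  SGraph (@complete_rel_sym n) (@complete_rel_irrefl n).

(* The vertices are numbered by [enum_val], the enumeration of the finType. *)
Definition adjacency (R : pzSemiRingType) (G : sgraph) : 'M[R]_#|G| :=
  \matrix_(i, j) (sedge (enum_val i) (enum_val j))%:R.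

(* The roots in R of the characteristic polynomial, repeated according to their
   multiplicity, in nonincreasing order. For a symmetric matrix these are all
   the eigenvalues, see [char_poly_eigenvalues] and [size_eigenvalues]. *)
Definition eigenvalues (R : rcfType) (n : nat) (A : 'M[R]_n) : seq R :=
  sort >=%R
    (flatten [seq nseq (mup x (char_poly A)) x | x <- rootsR (char_poly A)]).

(* The indices start at 0, so [sg_eigenvalue R G 0] is the largest one. *)
Definition sg_eigenvalue (R : rcfType) (G : sgraph) (i : 'I_#|G|) : R :=
  (eigenvalues (adjacency R G))`_i.

Definition neg_energy (R : rcfType) (p : nat) (G : sgraph) : R :=
  \sum_(i < #|G| | sg_eigenvalue R i < 0) `|sg_eigenvalue R i| ^+ p.

Lemma symmetric_char_poly_split (R : rcfType) (n : nat) (A : 'M[R]_n) :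
  A^T = A -> exists s : seq R, char_poly A = \prod_(x <- s) ('X - x%:P).
Proof.
move=> symA; pose f := @real_complex R.
pose B := map_mx f A.
have hermB : B \is hermsymmx.
  apply/is_hermitianmxP; rewrite expr0 scale1r; apply/matrixP => i j.
  by rewrite !mxE -{1}symA mxE /f /= /Num.conj /= oppr0.
have /orthomx_spectralP defB := hermitian_normalmx hermB.
set P := spectralmx B in defB; set d := spectral_diag B in defB.
have Pu : P \in unitmx by exact: spectral_unit.
have dreal i : d 0 i = f (complex.Re (d 0 i)).
  have /mxOverP/(_ 0 i) := hermitian_spectral_diag_real hermB.
  by move=> h; rewrite /f RRe_real.
exists [seq complex.Re (d 0 i) | i <- enum 'I_n].
apply: (map_poly_inj f); rewrite map_char_poly -/B big_map.
have -> : char_poly B = char_poly (diag_mx d).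
  rewrite /char_poly /char_poly_mx defB !map_mxM /=.
  pose Q := map_mx (@polyC _) P; pose Q' := map_mx (@polyC _) (invmx P).
  have QQ : Q' *m Q = 1%:M by rewrite -map_mxM mulVmx // map_mx1.
  have -> : 'X%:M - Q' *m map_mx (@polyC _) (diag_mx d) *m Q
            = Q' *m ('X%:M - map_mx (@polyC _) (diag_mx d)) *m Q.
    by rewrite mulmxBr mulmxBl scalar_mxC -(mulmxA _ Q' Q) QQ mulmx1.
  by rewrite !det_mulmx mulrAC -det_mulmx QQ det1 mul1r.
rewrite (char_poly_trig (diag_mx_is_trig _)) big_enum /= rmorph_prod.
apply: eq_bigr => i _.
by rewrite mxE eqxx mulr1n rmorphB /= map_polyX map_polyC /= [in LHS]dreal.
Qed.

Lemma char_poly_eigenvalues (R : rcfType) (n : nat) (A : 'M[R]_n) :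
  A^T = A -> char_poly A = \prod_(x <- eigenvalues A) ('X - x%:P).
Proof.
move=> /symmetric_char_poly_split [s defs].
rewrite [LHS]defs; apply: perm_big; rewrite perm_sym perm_sort defs.
apply/allP => /= x _; apply/eqP.
have s0 : \prod_(y <- s) ('X - y%:P) != 0 :> {poly R}.
  by rewrite monic_neq0 // monic_prod_XsubC.
have muE y : mup y (\prod_(z <- s) ('X - z%:P)) = count_mem y s.
  exact: mu_prod_XsubC.
rewrite count_flatten -map_comp sumnE big_map.
under eq_bigr => y _ do rewrite /= count_nseq muE /=.
have [xs | xNs] := boolP (x \in s).
  have xr : x \in rootsR (\prod_(y <- s) ('X - y%:P)).
    by rewrite -roots_on_rootsR //= root_prod_XsubC.
  rewrite (bigD1_seq x xr) /=; last first.
    exact: (sorted_uniq lt_trans ltxx (sorted_roots _ _ _)).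
  by rewrite eqxx mul1n big1 ?addn0 // => y /negbTE ->; rewrite mul0n.
rewrite (count_memPn xNs) big1 // => y _.
by case: eqP => [->|_]; rewrite ?mul0n // (count_memPn xNs).
Qed.

Lemma size_eigenvalues (R : rcfType) (n : nat) (A : 'M[R]_n) :
  A^T = A -> size (eigenvalues A) = n.
Proof.
move=> /char_poly_eigenvalues/(congr1 (size : {poly R} -> nat)).
by rewrite size_char_poly size_prod_XsubC => -[].
Qed.

Lemma adjacency_sym (R : pzSemiRingType) (G : sgraph) :
  (adjacency R G)^T = adjacency R G.
Proof. by apply/matrixP => i j; rewrite !mxE sedge_sym. Qed.

(* Main.v *)
(* Write f(A) for the trace of the cube of the negative part of A. Deleting a
   vertex v of degree d >= 1 lowers f of the adjacency matrix by at least 1.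
   Indeed f(A) >= - 3 tr(A Z^2) - 2 tr(Z^3) for every positive semidefinite Z,
   with equality when Z is the negative part of A. Let B be the adjacency matrix
   without v, let Y be its negative part, let u and b be the indicator vectors
   of v and of its neighbours, and let W be the projection on d u - b (for a
   complete graph, an eigenvector with eigenvalue -1). Evaluating the bound at
   Z = Y + W gives f(A) >= f(B) + 1, since b^T B b <= d (d - 1). Building a
   connected graph one vertex at a time, each new vertex being adjacent to a
   previous one, gives n - 1, the value at the complete graph, for p = 3.
   The case p > 3 follows by convexity, because the trace of A is 0, so at most
   n - 1 eigenvalues are negative. *)
Require Import Defs.
From mathcomp Require Import all_boot all_order all_algebra.
From mathcomp Require Import reals.
From mathcomp Require Import complex ring lra.

Set Implicit Arguments.
Unset Strict Implicit.
Unset Printing Implicit Defensive.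

Import Order.TTheory GRing.Theory Num.Theory.

Local Open Scope ring_scope.

(** * Positive semidefinite matrices and negative parts of Hermitian matrices *)

Section NegativePart.

Local Open Scope sesquilinear_scope.
Variable C : numClosedFieldType.

Lemma adjmxM m n p (A : 'M[C]_(m, n)) (B : 'M_(n, p)) :
  (A *m B)^t* = B^t* *m A^t*.
Proof. by rewrite trmx_mul map_mxM. Qed.

Lemma adjmxD m n (A B : 'M[C]_(m, n)) : (A + B)^t* = A^t* + B^t*.
Proof. by rewrite linearD map_mxD. Qed.

Lemma adjmxN m n (A : 'M[C]_(m, n)) : (- A)^t* = - A^t*.
Proof. by rewrite linearN map_mxN. Qed.

Lemma adjmxZ m n c (A : 'M[C]_(m, n)) : (c *: A)^t* = c^* *: A^t*.
Proof. by rewrite linearZ /= map_mxZ. Qed.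

Lemma mulmx_adj_ge0 m (x : 'rV[C]_m) : 0 <= (x *m x^t*) 0 0.
Proof.
rewrite mxE sumr_ge0 // => i _.
by rewrite !mxE mul_conjC_ge0.
Qed.

Lemma mulmx_adj_eq0 m (x : 'rV[C]_m) : (x *m x^t*) 0 0 = 0 -> x = 0.
Proof.
rewrite mxE => /eqP; rewrite psumr_eq0 => [/allP h|i _]; last first.
  by rewrite !mxE mul_conjC_ge0.
apply/rowP => i; have := h i (mem_index_enum _).
by rewrite !mxE mul_conjC_eq0 => /eqP.
Qed.

Definition psdmx n (M : 'M[C]_n) : Prop :=
  M^t* = M /\ forall x : 'rV_n, 0 <= (x *m M *m x^t*) 0 0.

Lemma psdmxD n (M N : 'M[C]_n) : psdmx M -> psdmx N -> psdmx (M + N).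
Proof.
move=> [hM pM] [hN pN]; split=> [|x]; first by rewrite adjmxD hM hN.
by rewrite mulmxDr mulmxDl mxE addr_ge0.
Qed.

Lemma psdmxZ n c (M : 'M[C]_n) : 0 <= c -> psdmx M -> psdmx (c *: M).
Proof.
move=> c0 [hM pM]; split=> [|x].
  by rewrite adjmxZ hM conj_Creal // ger0_real.
by rewrite -scalemxAr -scalemxAl mxE mulr_ge0.
Qed.

Lemma psdmx_gram n k (X : 'M[C]_(n, k)) : psdmx (X *m X^t*).
Proof.
split=> [|x]; first by rewrite adjmxM trmxCK.
by rewrite mulmxA -mulmxA -adjmxM mulmx_adj_ge0.
Qed.

Lemma psdmx_diag_conj n (d : 'rV[C]_n) (P : 'M_n) :
  (forall i, 0 <= d 0 i) -> psdmx (P^t* *m diag_mx d *m P).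
Proof.
move=> d0; split=> [|x].
  rewrite !adjmxM trmxCK mulmxA; congr (_ *m _ *m _).
  apply/matrixP => i j; rewrite !mxE rmorphMn /=.
  rewrite conj_Creal ?ger0_real // eq_sym.
  by case: eqP => [->|].
rewrite !mulmxA -mulmxA -{2}(trmxCK P) -adjmxM; set y := x *m _.
rewrite mul_mx_diag mxE sumr_ge0 // => i _.
by rewrite !mxE mulrAC mulr_ge0 // mul_conjC_ge0.
Qed.

Lemma mxtrace_psd_ge0 m n (P : 'M[C]_n) (X : 'M_(m, n)) :
  psdmx P -> 0 <= \tr (X *m P *m X^t*).
Proof.
move=> [_ pP]; rewrite sumr_ge0 // => i _.
suff -> : (X *m P *m X^t*) i i = (row i X *m P *m (row i X)^t*) 0 0 by [].
rewrite -row_mul !mxE; apply: eq_bigr => j _; by rewrite !mxE.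
Qed.

(* The difference of the two sides is the trace of
   [(M - Z) (M + 2 Z) (M - Z)]. *)
Lemma mxtrace_psd_young n (M Z : 'M[C]_n) : psdmx M -> psdmx Z ->
  3 * \tr (M *m Z *m Z) <= \tr (M *m M *m M) + 2 * \tr (Z *m Z *m Z).
Proof.
move=> pM pZ.
have p2 : psdmx (M + 2 *: Z) by apply: psdmxD => //; apply: psdmxZ.
have := mxtrace_psd_ge0 (M - Z) p2.
rewrite adjmxD adjmxN pM.1 pZ.1.
rewrite !(mulmxDl, mulmxDr, mulNmx, mulmxN) -!(scalemxAl, scalemxAr).
rewrite !(mxtraceD, linearN) /= !mxtraceZ.
have e1 : \tr (M *m Z *m M) = \tr (M *m M *m Z).
  by rewrite mxtrace_mulC mulmxA.
have e2 : \tr (Z *m M *m M) = \tr (M *m M *m Z).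
  by rewrite -mulmxA mxtrace_mulC.
have e3 : \tr (Z *m M *m Z) = \tr (M *m Z *m Z).
  by rewrite -mulmxA mxtrace_mulC.
have e4 : \tr (Z *m Z *m M) = \tr (M *m Z *m Z).
  by rewrite mxtrace_mulC mulmxA.
rewrite e1 e2 e3 e4 => h; rewrite -subr_ge0; move: h.
by congr (is_true (0 <= _)); ring.
Qed.

(** The last equation reads [(A + M) *m M = 0]: the matrix [A] is the difference of the positive
    semidefinite [A + M] and [M], whose product vanishes. This characterises the negative part by
    identities that need no diagonalisation. *)
Definition negpart n (A M : 'M[C]_n) : Prop :=
  [/\ psdmx M, psdmx (A + M) & A *m M = - (M *m M)].

Lemma negpart_adj n (A M : 'M[C]_n) : negpart A M -> A^t* = A.
Proof.
case=> [[hM _] [hAM _] _]; move: hAM.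
by rewrite adjmxD hM => /addIr.
Qed.

Lemma negpart_mulC n (A M : 'M[C]_n) : negpart A M -> M *m A = - (M *m M).
Proof.
move=> nAM; have hA := negpart_adj nAM; case: nAM => [[hM _] _ /(congr1 (fun X => X^t*))].
by rewrite adjmxM adjmxN adjmxM hM hA.
Qed.

Lemma negpart_cube_ge0 n (A M : 'M[C]_n) :
  negpart A M -> 0 <= \tr (M *m M *m M).
Proof. by case=> pM _ _; rewrite -{3}pM.1 mxtrace_psd_ge0. Qed.

(** As [A + M] is positive semidefinite, the trace of [Z (A + M) Z] is nonnegative, so
    [mxtrace_psd_young] stays true with [- A] in place of [M] in its mixed term. *)
Lemma negpart_cube_ge n (A M Z : 'M[C]_n) : negpart A M -> psdmx Z ->
  - 3 * \tr (A *m Z *m Z) - 2 * \tr (Z *m Z *m Z) <= \tr (M *m M *m M).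
Proof.
move=> [pM pAM _] pZ; have := mxtrace_psd_young pM pZ.
have := mxtrace_psd_ge0 Z pAM.
rewrite pZ.1 mulmxDr mulmxDl mxtraceD.
rewrite -!(mulmxA Z) !(mxtrace_mulC Z) => h1 h2.
rewrite -subr_ge0.
have -> : \tr (M *m M *m M) - (- 3 * \tr (A *m Z *m Z) - 2 * \tr (Z *m Z *m Z))
  = 3 * (\tr (A *m Z *m Z) + \tr (M *m Z *m Z))
    + ((\tr (M *m M *m M) + 2 * \tr (Z *m Z *m Z)) - 3 * \tr (M *m Z *m Z)).
  by ring.
by rewrite addr_ge0 ?subr_ge0 // mulr_ge0.
Qed.

(** From [M A = - M M] follows [M M u = 0], hence the squared norm of [M u] is 0. *)
Lemma negpart_ker n (A M : 'M[C]_n) (u : 'cV_n) :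
  negpart A M -> A *m u = 0 -> M *m u = 0.
Proof.
move=> nAM Au; have hMA := negpart_mulC nAM; case: nAM => [[hM _] _ _].
have MMu : M *m (M *m u) = 0.
  by rewrite mulmxA -[M *m M]opprK -hMA mulNmx -mulmxA Au mulmx0 oppr0.
have : (M *m u)^t* = 0.
  apply: mulmx_adj_eq0.
  by rewrite trmxCK adjmxM hM -mulmxA MMu mulmx0 mxE.
by move/(congr1 (fun X => X^t*)); rewrite trmxCK linear0 map_mx0.
Qed.

Lemma mxtrace_outer n (X : 'M[C]_n) (q : 'cV_n) :
  \tr (X *m (q *m q^t*)) = \tr (q^t* *m X *m q).
Proof. by rewrite mulmxA mxtrace_mulC mulmxA. Qed.

(** The matrix form of adding a vertex [u] with neighbourhood [b] of size [d]. The proof expands the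
    bound [negpart_cube_ge] at [Z = Y + W] into traces of words in [B], [K], [Y] and [W]. *)
Lemma negpart_cube_add_vertex n (B Y M : 'M[C]_n) (u b : 'cV_n) (d : C) :
    negpart B Y -> negpart (B + u *m b^t* + b *m u^t*) M ->
    u^t* *m u = 1%:M -> u^t* *m b = 0 -> b^t* *m b = d%:M -> B *m u = 0 ->
    1 <= d -> \tr (b^t* *m B *m b) <= d * (d - 1) ->
  \tr (Y *m Y *m Y) + 1 <= \tr (M *m M *m M).
Proof.
move=> nBY nAM uu ub bb Bu d1 hb.
have d0 : 0 < d := lt_le_trans ltr01 d1.
have d_conj : d^* = d by rewrite conj_Creal // gtr0_real.
have bu : b^t* *m u = 0.
  by rewrite -[u]trmxCK -adjmxM ub linear0 map_mx0.
have hB := negpart_adj nBY; have YB := negpart_mulC nBY.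
have Yu := negpart_ker nBY Bu.
have [pY _ BY] := nBY; have [hY _] := pY.
have uB : u^t* *m B = 0 by rewrite -hB -adjmxM Bu linear0 map_mx0.
have uY : u^t* *m Y = 0 by rewrite -hY -adjmxM Yu linear0 map_mx0.
(* The squared norm of [q] is [d ^+ 2 + d], so this [k] makes [W] the orthogonal projection on the
   line of [q]. *)
pose q := d *: u - b; pose k := (d * (d + 1))^-1.
pose K := u *m b^t* + b *m u^t*; pose W := k *: (q *m q^t*).
have k_def : k * (d * (d + 1)) = 1.
  by rewrite mulVf // mulf_neq0 ?gt_eqF // ltr_wpDr.
have k0 : 0 <= k by rewrite invr_ge0 mulr_ge0 ?addr_ge0 // ltW.
have pW : psdmx W by apply: psdmxZ => //; exact: psdmx_gram.
have qE : q^t* = d *: u^t* - b^t* by rewrite adjmxD adjmxN adjmxZ d_conj.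
have qq : q^t* *m q = (d * (d + 1))%:M.
  rewrite qE mulmxBl !mulmxBr -!(scalemxAl, scalemxAr) uu ub bu bb.
  rewrite !scaler0 subr0 sub0r opprK !scale_scalar_mx -raddfD /=.
  by congr (_%:M); ring.
have WW : W *m W = W.
  rewrite /W -scalemxAl -scalemxAr mulmxA -(mulmxA q) qq mul_mx_scalar.
  by rewrite -scalemxAl; congr (_ *: _); rewrite scalerA k_def scale1r.
have trW : \tr W = 1.
  by rewrite /W mxtraceZ mxtrace_mulC qq mxtrace_scalar mulr1n.
have Yq : Y *m q = - (Y *m b).
  by rewrite mulmxBr -scalemxAr Yu scaler0 sub0r.
have qY : q^t* *m Y = - (b^t* *m Y).
  by rewrite qE mulmxBl -scalemxAl uY scaler0 sub0r.
have Kq : K *m q = d *: b - d *: u.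
  rewrite /K mulmxDl -!mulmxA !mulmxBr -!scalemxAr uu bu ub bb.
  rewrite !mulmx0 !scaler0 sub0r subr0 mulmx1 mul_mx_scalar.
  by rewrite addrC.
have qK : q^t* *m K = d *: b^t* - d *: u^t*.
  have KE : K^t* = K by rewrite /K adjmxD !adjmxM !trmxCK addrC.
  by rewrite -KE -adjmxM Kq adjmxD adjmxN !adjmxZ d_conj.
pose y := \tr (b^t* *m Y *m b).
have y0 : 0 <= y.
  by have := mxtrace_psd_ge0 (b^t*) pY; rewrite trmxCK.
have trYW : \tr (Y *m W) = k * y.
  rewrite /W -scalemxAr mxtraceZ mxtrace_outer qY mulNmx -mulmxA Yq.
  by rewrite mulmxN opprK mulmxA.
have trKYW : \tr (K *m Y *m W) = - (k * d * y).
  rewrite /W -scalemxAr mxtraceZ mxtrace_outer mulmxA qK -mulmxA Yq.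
  rewrite mulmxN mulmxBl -!scalemxAl !mulmxA uY mul0mx scaler0 subr0.
  by rewrite linearN /= mxtraceZ mulrN mulrA.
have trKWY : \tr (K *m W *m Y) = - (k * d * y).
  rewrite mxtrace_mulC mulmxA /W -scalemxAr mxtraceZ mxtrace_outer mulmxA.
  rewrite qY -mulmxA Kq mulNmx mulmxBr -!scalemxAr -!mulmxA Yu mulmx0.
  by rewrite scaler0 subr0 linearN /= mxtraceZ mulrN mulrA mulmxA.
have trKW : \tr (K *m W) = - (2 * k * d ^+ 2).
  rewrite /W -scalemxAr mxtraceZ mxtrace_outer qK.
  rewrite mulmxBl !mulmxBr -!(scalemxAl, scalemxAr) uu bu ub bb.
  rewrite !scaler0 sub0r subr0 !scale_scalar_mx linearB linearN /=.
  by rewrite !mxtrace_scalar !mulr1n; ring.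
have trBW : \tr (B *m W) = k * \tr (b^t* *m B *m b).
  rewrite /W -scalemxAr mxtraceZ mxtrace_outer qE.
  rewrite mulmxBl -scalemxAl uB scaler0 sub0r mulNmx /q mulmxBr -scalemxAr.
  by rewrite -!mulmxA Bu mulmx0 scaler0 sub0r opprK.
have KYY : \tr (K *m Y *m Y) = 0.
  rewrite /K !mulmxDl -(mulmxA b) uY mulmx0 mul0mx addr0 mxtrace_mulC.
  by rewrite !mulmxA Yu !mul0mx linear0.
have cube : \tr ((Y + W) *m (Y + W) *m (Y + W))
    = \tr (Y *m Y *m Y) + 3 * \tr (Y *m Y *m W) + 3 * (k * y) + 1.
  rewrite !(mulmxDl, mulmxDr) !mxtraceD -(mulmxA Y W W) -(mulmxA W Y W) WW.
  rewrite WW (mxtrace_mulC W (Y *m W)) -(mulmxA Y W W) WW (mxtrace_mulC W Y).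
  rewrite trYW trW (mxtrace_mulC (Y *m W)) mulmxA -(mulmxA W Y Y).
  by rewrite (mxtrace_mulC W (Y *m Y)); ring.
have mixed : \tr ((B + K) *m (Y + W) *m (Y + W))
    = - \tr (Y *m Y *m Y) - 2 * \tr (Y *m Y *m W) - 2 * (k * d * y)
      + k * \tr (b^t* *m B *m b) - 2 * k * d ^+ 2.
  clearbody K; rewrite !(mulmxDl, mulmxDr) !mxtraceD -(mulmxA B W W) -(mulmxA K W W) WW.
  rewrite (mxtrace_mulC (B *m W) Y) mulmxA YB BY !mulNmx !linearN /=.
  by rewrite KYY trKYW trKWY trBW trKW; ring.
have := negpart_cube_ge (Z := Y + W) nAM (psdmxD pY pW).
rewrite -addrA -/K cube mixed; apply: le_trans; rewrite -subr_ge0.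
set beta := \tr (b^t* *m B *m b) in hb *.
(* The surplus of the bound over the claim: the first term is nonnegative by [1 <= d], the second by
   the hypothesis on [beta], and the third vanishes by the choice of [k]. *)
rewrite [X in 0 <= X](_ : _ = 6 * (k * ((d - 1) * y))
  + 3 * (k * (d * (d - 1) - beta)) + 3 * (k * (d * (d + 1)) - 1)); last by ring.
rewrite k_def subrr mulr0 addr0 addr_ge0 // !mulr_ge0 // subr_ge0 //.
Qed.

Lemma char_poly_similar n (P A : 'M[C]_n) : P \in unitmx ->
  char_poly (invmx P *m A *m P) = char_poly A.
Proof.
move=> Pu; rewrite /char_poly /char_poly_mx !map_mxM.
set Q := map_mx polyC P; set Q' := map_mx polyC (invmx P).
have QQ : Q' *m Q = 1%:M by rewrite -map_mxM mulVmx // map_mx1.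
have -> : 'X%:M - Q' *m map_mx polyC A *m Q
          = Q' *m ('X%:M - map_mx polyC A) *m Q.
  by rewrite mulmxBr mulmxBl scalar_mxC -(mulmxA _ Q' Q) QQ mulmx1.
by rewrite !det_mulmx mulrAC -det_mulmx QQ det1 mul1r.
Qed.

(** In a unitary eigenbasis, negate the negative eigenvalues and replace the others by 0. The
    eigenvalues [d] are exported so that the trace can later be matched with the energy. *)
Lemma negpart_exists n (A : 'M[C]_n) : A^t* = A ->
  exists M (d : 'rV[C]_n), [/\ negpart A M,
    char_poly A = \prod_i ('X - (d 0 i)%:P) &
    \tr (M *m M *m M) = \sum_i (if d 0 i < 0 then - d 0 i else 0) ^+ 3].
Proof.
move=> hA.
have Aherm : A \is hermsymmx.
  by apply/is_hermitianmxP; rewrite expr0 scale1r hA.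
have /orthomx_spectralP := hermitian_normalmx Aherm.
set P := spectralmx A; set d := spectral_diag A => defA.
have Pu : P \in unitmx by exact: spectral_unit.
have dreal i : d 0 i \is Num.real.
  by have /mxOverP/(_ 0 i) := hermitian_spectral_diag_real Aherm.
have PE : invmx P = P^t* by rewrite invmx_unitary // spectral_unitarymx.
pose m : 'rV[C]_n := \row_i (if d 0 i < 0 then - d 0 i else 0).
have m0 i : 0 <= m 0 i.
  by rewrite mxE; case: ifP => // h; rewrite oppr_ge0 ltW.
have dm0 i : 0 <= (d + m) 0 i.
  rewrite !mxE; case: ifP => [|/negbT]; first by rewrite subrr.
  by rewrite addr0 -real_leNgt.
have conjM (x y : 'rV[C]_n) : P^t* *m diag_mx x *m P *m (P^t* *m diag_mx y *m P)
    = P^t* *m diag_mx (\row_i (x 0 i * y 0 i)) *m P.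
  rewrite -PE -!mulmxA (mulmxA P) mulmxV // mul1mx !mulmxA -(mulmxA (invmx P)).
  by rewrite mulmx_diag.
exists (P^t* *m diag_mx m *m P), d; split; last first.
- rewrite !conjM -mulmxA mxtrace_mulC -PE mulmxK // mxtrace_diag.
  by apply: eq_bigr => i _; rewrite !mxE !exprS expr0 mulr1 mulrA.
- rewrite {1}defA char_poly_similar // char_poly_trig ?diag_mx_is_trig //.
  by apply: eq_bigr => i _; rewrite mxE eqxx mulr1n.
rewrite defA PE; split; first exact: psdmx_diag_conj.
  by rewrite -mulmxDl -mulmxDr -raddfD /=; exact: psdmx_diag_conj.
rewrite !conjM -mulNmx -mulmxN -raddfN /=; congr (_ *m diag_mx _ *m _).
apply/rowP => i; rewrite !mxE; case: ifP => _; last by rewrite !mulr0 oppr0.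
by rewrite mulNr opprK.
Qed.

(** * Growing a connected graph one vertex at a time *)

Section Growth.

Variables (n : nat) (e : rel 'I_n).
Hypotheses (e_sym : symmetric e) (e_irr : irreflexive e).

(* Keeping the full size, with zeros outside [S], only adds zero eigenvalues. *)
Definition induced_adj (S : {set 'I_n}) : 'M[C]_n :=
  \matrix_(i, j) (e i j && (i \in S) && (j \in S))%:R.

Lemma induced_adj_herm S : (induced_adj S)^t* = induced_adj S.
Proof.
by apply/matrixP => i j; rewrite !mxE conjC_nat e_sym andbAC.
Qed.

(** An instance of [negpart_cube_add_vertex] with [d] the number of neighbours of [v] in [S]; the
    neighbour [w] ensures [1 <= d]. *)
Lemma negpart_cube_setU1 (S : {set 'I_n}) v w Y M :
  v \notin S -> w \in S -> e v w ->
  negpart (induced_adj S) Y -> negpart (induced_adj (v |: S)) M ->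
  \tr (Y *m Y *m Y) + 1 <= \tr (M *m M *m M).
Proof.
move=> vS wS evw nY nM.
pose N := [set j in S | e v j].
pose u : 'cV[C]_n := delta_mx v 0.
pose b : 'cV[C]_n := \col_j (j \in N)%:R.
have vN : v \notin N by rewrite inE (negbTE vS).
have N1 : (0 < #|N|)%N by apply/card_gt0P; exists w; rewrite inE wS.
have utE : u^t* = delta_mx 0 v.
  by apply/matrixP => i j; rewrite !mxE conjC_nat andbC.
have btE : b^t* = \row_j (j \in N)%:R.
  by apply/matrixP => i j; rewrite !mxE conjC_nat.
have sumN (F : 'I_n -> C) : \sum_j (j \in N)%:R * F j = \sum_(j in N) F j.
  rewrite [RHS]big_mkcond /=; apply: eq_bigr => j _.
  by case: ifP; rewrite ?mul1r ?mul0r.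
apply: (@negpart_cube_add_vertex _ _ _ _ u b #|N|%:R nY).
- suff <- : induced_adj (v |: S) = induced_adj S + u *m b^t* + b *m u^t* by [].
  apply/matrixP => i j; rewrite utE btE !mxE !big_ord1 !mxE !inE !eqxx !andbT /=.
  have [-> | iv] := eqVneq i v; have [-> | jv] := eqVneq j v.
  + by rewrite e_irr (negbTE vS) /= mulr0 mul0r !addr0.
  + by rewrite (negbTE vS) andbF /= mul1r mulr0 addr0 add0r andbT andbC.
  + by rewrite (negbTE vS) andbF /= mul0r mulr1 !add0r andbT e_sym andbC.
  + by rewrite /= mul0r mulr0 !addr0.
- by rewrite utE mul_delta_mx; apply/matrixP => i j; rewrite !ord1 !mxE eqxx.
- by rewrite utE -rowE; apply/matrixP => i j; rewrite !mxE (negbTE vN).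
- apply/matrixP => i j; rewrite btE !ord1 !mxE eqxx mulr1n.
  under eq_bigr => k _ do rewrite !mxE.
  rewrite sumN (eq_bigr (fun=> 1)) => [|k ->] //.
  by rewrite sumr_const.
- by rewrite -colE; apply/matrixP => i j; rewrite !mxE (negbTE vS) andbF.
- by rewrite ler1n.
(* The trace counts the ordered pairs of adjacent vertices of [N]. Adding the [#|N|] diagonal pairs,
   which are never edges, gives at most all pairs. *)
rewrite trace_mx11 -mulmxA btE mxE.
under eq_bigr => j _ do rewrite mxE.
rewrite sumN mulrBr mulr1 -natrM lerBrDr.
apply: (@le_trans _ _ (\sum_(i in N) \sum_(j in N) 1)); last first.
  by rewrite !sumr_const -mulrnA.
rewrite -[X in _ + X%:R]sum1_card natr_sum -big_split /=.
apply: ler_sum => i iN; rewrite mxE.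
rewrite (eq_bigr (fun j => (j \in N)%:R
    * (e i j && (i \in S) && (j \in S))%:R)) => [|j _]; last first.
  by rewrite !mxE mulrC.
rewrite sumN (bigD1 i) //= e_irr add0r [leRHS](bigD1 i) //= addrC lerD2l.
by apply: ler_sum => j _; rewrite lern1 leq_b1.
Qed.

Lemma negpart_cube_connected M :
  (0 < n)%N -> (forall x y, connect e x y) ->
  negpart (induced_adj setT) M -> n.-1%:R <= \tr (M *m M *m M).
Proof.
move=> n0 conn nM.
(* Induction on [k] will give a set of [k.+1] vertices with bound [k], starting from a single
   vertex; at [k = n.-1] the set is everything. *)
suff [S [cS hS]] : exists S : {set 'I_n}, #|S| = n.-1.+1 /\
    forall M, negpart (induced_adj S) M -> n.-1%:R <= \tr (M *m M *m M).
  suff ST : S = setT by apply: hS; rewrite ST.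
  by apply/eqP; rewrite eqEcard subsetT cardsT card_ord cS prednK /=.
have : (n.-1 < n)%N by rewrite prednK.
elim: n.-1 => [|k IHk] kn.
  exists [set Ordinal n0]; rewrite cards1; split=> // {nM}M nM.
  exact: negpart_cube_ge0 nM.
have [S [cS hS]] := IHk (ltnW kn).
(* Some edge leaves [S]: otherwise [S] is closed under adjacency, hence full by connectedness,
   although it has fewer than [n] elements. *)
have : ~~ [forall x in S, forall y, e x y ==> (y \in S)].
  apply/negP => /forall_inP h.
  have S_closed : closed e S.
    move=> x y exy; apply/idP/idP => [xS|yS].
      by have /forallP/(_ y)/implyP := h x xS; apply.
    by have /forallP/(_ x)/implyP := h y yS; apply; rewrite e_sym.
  have [x xS] : exists x, x \in S by apply/card_gt0P; rewrite cS.
  have ST : S = setT.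
    by apply/setP => y; rewrite inE -(closed_connect S_closed (conn x y)).
  by move: kn; rewrite -cS ST cardsT card_ord ltnn.
rewrite negb_forall_in => /exists_inP[w wS].
rewrite negb_forall => /existsP[v]; rewrite negb_imply => /andP[ewv vS].
exists (v |: S); rewrite cardsU1 vS cS; split=> // {nM}M nM.
have [Y [_ [nY _ _]]] := negpart_exists (induced_adj_herm S).
rewrite -[k.+1]addn1 natrD; apply: le_trans (negpart_cube_setU1 vS wS _ nY nM).
  by rewrite lerD2r hS.
by rewrite e_sym.
Qed.

End Growth.

End NegativePart.

(** * From traces to negative energies, and from exponent 3 to [p] *)

Section Energy.

Variable R : rcfType.

Lemma neg_energyE p (G : sgraph) :
  neg_energy R p G = \sum_(x <- eigenvalues (adjacency R G) | x < 0) `|x| ^+ p.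
Proof.
by rewrite (big_nth 0) size_eigenvalues ?adjacency_sym // big_mkord.
Qed.

Lemma adjacency_trace (G : sgraph) : \tr (adjacency R G) = 0.
Proof. by apply: big1 => i _; rewrite mxE sedge_irrefl. Qed.

(** Up to sign, both sides are the coefficient of degree [n - 1] of the characteristic polynomial;
    size 0 has no such coefficient and is treated apart. *)
Lemma sum_eigenvalues n (A : 'M[R]_n) :
  A^T = A -> \sum_(x <- eigenvalues A) x = \tr A.
Proof.
case: n A => [|n] A symA.
  have := size_eigenvalues symA; case: eigenvalues => // _.
  by rewrite big_nil /mxtrace big_ord0.
apply: oppr_inj; rewrite -char_poly_trace // char_poly_eigenvalues //.
by rewrite -coefPn_prod_XsubC size_eigenvalues.
Qed.

Lemma count_neg_eigenvalues (G : sgraph) : (0 < #|G|)%N ->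
  (count (fun x => (x < 0)%R) (eigenvalues (adjacency R G)) <= #|G|.-1)%N.
Proof.
move=> G0; have symA := adjacency_sym R G.
have szA := size_eigenvalues symA.
rewrite -ltnS prednK // -[X in (_ < X)%N]szA ltn_neqAle count_size andbT.
rewrite -all_count.
apply/negP => /allP neg.
have : \sum_(x <- eigenvalues (adjacency R G)) x < 0.
  have := size_eigenvalues symA; move: neg.
  case: (eigenvalues _) => [_ sz|x s neg _]; first by rewrite -sz in G0.
  rewrite big_cons ltr_nwDl ?neg ?mem_head // big_seq.
  by apply: sumr_le0 => y ys; rewrite ltW // neg // in_cons ys orbT.
by rewrite sum_eigenvalues // adjacency_trace ltxx.
Qed.

(** Adding [v 0 j] to the eigenvalue equation gives [(x + 1) * v 0 j = s], with [s] the sum of the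
    entries. Either [s = 0] and [x = - 1], or summing over [j] gives [x + 1 = n]. *)
Lemma complete_graph_neg_eigenvalue n x :
  x \in eigenvalues (adjacency R (complete_graph n)) -> x < 0 -> x = - 1.
Proof.
rewrite -root_prod_XsubC -char_poly_eigenvalues ?adjacency_sym //.
rewrite -eigenvalue_root_char => /eigenvalueP[v vA v0] x0.
pose s := \sum_j v 0 j.
have vE j : (x + 1) * v 0 j = s.
  have /rowP/(_ j) := vA; rewrite !mxE mulrDl mul1r => <-.
  rewrite /s [RHS](bigD1 j) //= addrC; congr (_ + _).
  rewrite (bigD1 j) //= mxE sedge_irrefl mulr0 add0r.
  apply: eq_bigr => i ij.
  by rewrite mxE /= /complete_rel (inj_eq enum_val_inj) ij mulr1.
have sE : (x + 1) * s = #|complete_graph n|%:R * s.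
  rewrite {1}/s mulr_sumr (eq_bigr (fun=> s)) //.
  by rewrite sumr_const card_ord mulr_natl.
have [s0|s0] := eqVneq s 0.
  have /rV0Pn[j vj] := v0.
  have /eqP := vE j; rewrite s0 mulf_eq0 (negbTE vj) orbF.
  by rewrite addr_eq0 => /eqP.
have [j _] := rV0Pn _ v0.
(* The index [j] shows that there is a vertex, so [x + 1 = n] contradicts [x < 0]. *)
have := mulIf s0 sE; have := leq_ltn_trans (leq0n j) (ltn_ord j).
by rewrite -(ler_nat R) => n1 xn; move: x0; lra.
Qed.

Lemma neg_energy_complete_le n p : (0 < n)%N ->
  neg_energy R p (complete_graph n) <= n.-1%:R.
Proof.
move=> n0; rewrite neg_energyE big_seq_cond.
rewrite (eq_bigr (fun=> 1)) => [|x /andP[xs x0]]; last first.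
  by rewrite (complete_graph_neg_eigenvalue xs x0) normrN1 expr1n.
have cardK : #|complete_graph n| = n by rewrite card_ord.
rewrite -big_seq_cond big_const_seq iter_addr_0 ler_nat.
by apply: leq_trans (count_neg_eigenvalues _) _; rewrite cardK.
Qed.

(** The trace bound holds over [R[i]]. It descends to [R] because both lists of eigenvalues factor
    the same characteristic polynomial and so agree up to permutation. *)
Lemma cube_neg_energy_ge (G : sgraph) : (0 < #|G|)%N -> sg_connected G ->
  #|G|.-1%:R <= neg_energy R 3 G.
Proof.
move=> G0 conn; have symA := adjacency_sym R G.
pose e : rel 'I_#|G| := fun i j => sedge (enum_val i) (enum_val j).
have e_sym : symmetric e by move=> i j; exact: sedge_sym.
have e_irr : irreflexive e by move=> i; exact: sedge_irrefl.
have e_conn x y : connect e x y.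
  have /connectP[s] := conn (enum_val x) (enum_val y).
  elim: s x => [x _ /enum_val_inj -> //|z s IHs x /= /andP[xz zs] yE].
  apply: (connect_trans (y := enum_rank z)).
    by apply: connect1; rewrite /e enum_rankK.
  by apply: IHs; rewrite enum_rankK.
pose C := R[i]; pose B := induced_adj C e setT.
have BE : B = map_mx (real_complex R) (adjacency R G).
  by apply/matrixP => i j; rewrite !mxE !inE !andbT rmorph_nat.
have [M [d [nM chi trM]]] := negpart_exists (induced_adj_herm C e_sym setT).
have := negpart_cube_connected e_sym e_irr G0 e_conn nM.
rewrite trM -lecR rmorph_nat; congr (is_true (_ <= _)).
pose g (z : C) := (if z < 0 then - z else 0) ^+ 3.
have /prod_XsubC_eq ds : \prod_(z <- [seq d 0 i | i <- index_enum 'I_#|G|]) ('X - z%:P)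
   = \prod_(z <- map (real_complex R) (eigenvalues (adjacency R G))) ('X - z%:P).
  rewrite [LHS]big_map -chi -/B BE -map_char_poly.
  by rewrite (char_poly_eigenvalues symA) map_prod_XsubC big_map.
transitivity (\sum_(z <- [seq d 0 i | i <- index_enum 'I_#|G|]) g z).
  by rewrite big_map.
rewrite (perm_big _ ds) big_map neg_energyE rmorph_sum [RHS]big_mkcond /=.
apply: eq_bigr => x _; rewrite /g ltcR.
by case: ifP => x0; rewrite ?expr0n // ltr0_norm // -rmorphN -rmorphXn.
Qed.

(** With [s = t ^+ 3], the convex function [s] to the power [1 + k / 3] lies above its tangent at
    [s = 1]. Induction on [k] avoids fractional powers. *)
Lemma exp_sub_cube_ge (t : R) k : 0 <= t ->
  k%:R * (t ^+ 3 - 1) <= 3 * (t ^+ (k + 3) - t ^+ 3).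
Proof.
move=> t0; elim: k => [|k IHk]; first by rewrite mul0r subrr mulr0.
suff step : t ^+ 3 - 1 <= 3 * (t ^+ (k.+1 + 3) - t ^+ (k + 3)).
  by rewrite -[k.+1]addn1 natrD; move: IHk step; rewrite addn1; lra.
(* The factors [t ^+ k - 1] and [t - 1] have the same sign, which reduces the step to [k = 0]. *)
have tk : t - 1 <= t ^+ k * (t - 1).
  rewrite -subr_ge0 -[X in _ - X]mul1r -mulrBl.
  have [t1|/ltW t1] := leP 1 t; first by rewrite mulr_ge0 ?subr_ge0 ?exprn_ege1.
  by rewrite mulr_le0 ?subr_le0 ?exprn_ile1.
have : t ^+ 3 * (t - 1) <= t ^+ 3 * (t ^+ k * (t - 1)).
  by rewrite ler_wpM2l ?exprn_ge0.
rewrite addSn [t ^+ (k + 3).+1]exprS exprD; move: (t ^+ k) => q h.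
(* This product equals [3 * t ^+ 4 - 4 * t ^+ 3 + 1], the difference of the two sides at [k = 0]. *)
have : 0 <= (t - 1) ^+ 2 * (3 * t ^+ 2 + 2 * t + 1).
  by rewrite mulr_ge0 ?sqr_ge0 // !addr_ge0 ?mulr_ge0 ?exprn_ge0.
by nra.
Qed.

(** Summing [exp_sub_cube_ge] over the negative eigenvalues bounds three times the gain from below
    by [p - 3] times the excess of the cubic energy over their number, which is at most
    [#|G|.-1]. *)
Lemma cube_neg_energy_le (G : sgraph) p :
    (0 < #|G|)%N -> (3 <= p)%N -> #|G|.-1%:R <= neg_energy R 3 G ->
  neg_energy R 3 G <= neg_energy R p G.
Proof.
move=> G0 p3 h3; rewrite -subr_ge0 -(pmulr_rge0 _ (ltr0n R 3)).
pose s := eigenvalues (adjacency R G).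
have h : (p - 3)%:R * (neg_energy R 3 G - (count (fun x => (x < 0)%R) s)%:R)
    <= 3 * (neg_energy R p G - neg_energy R 3 G).
  have -> : (count (fun x => (x < 0)%R) s)%:R = \sum_(x <- s | x < 0) 1 :> R.
    by rewrite big_const_seq iter_addr_0.
  rewrite !neg_energyE -!sumrB !mulr_sumr; apply: ler_sum => x _.
  by rewrite -{2}(subnK p3) exp_sub_cube_ge.
apply: le_trans h; rewrite mulr_ge0 // subr_ge0 (le_trans _ h3) // ler_nat.
exact: count_neg_eigenvalues.
Qed.

End Energy.

Theorem corollary1p7 (R : realType) (n p : nat) (hn : (0 < n)%N)
    (hp : (3 <= p)%N) (G : sgraph) (hG : #|G| = n) (hconn : sg_connected G) :
  neg_energy R p (complete_graph n) <= neg_energy R p G.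
Proof.
have G0 : (0 < #|G|)%N by rewrite hG.
have h3 := cube_neg_energy_ge R G0 hconn.
apply: le_trans (neg_energy_complete_le R p hn) _.
by rewrite -hG (le_trans h3) // cube_neg_energy_le.
Qed.
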